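(* Let $\mathrm{X}=(X_n)_{n\ge1}$ be a sequence of random variables in $\mathbb{T}$, each distributed according to Lebesgue measure, and let $\mathrm{r}=(r_n)_{n\ge1}$ be a sequence of reals in $(0,1]$. Let $G$ be a nonempty compact subset of $\mathbb{T}$ and $g$ a gauge function with $\mathcal{H}^g(G)>0$. If $\Theta(\mathrm{X},\mathcal{B}(\mathrm{r}))<\infty$ and $\sum_{n}r_n/g(r_n)=\infty$, then almost surely $\mathcal{E}(\mathrm{X},\mathrm{r})\cap G\neq\emptyset$.
   Context: $\mathbb{T}=\mathbb{R}/\mathbb{Z}$ with quotient distance $d$. $\mathcal{E}(\mathrm{X},\mathrm{r})=\{\xi\in\mathbb{T}: d(\xi,X_n)<r_n\text{ for infinitely many }n\}$. A gauge function is a nondecreasing right-continuous function on $[0,\infty)$ vanishing at zero and only at zero; $\mathcal{H}^g$ is the Hausdorff $g$-measure. For a sequence $\mathrm{B}=(B_n)_{n\ge1}$ of Borel subsets of $\mathbb{T}$ of positive Lebesgue measure, $\theta(\mathrm{X},\mathrm{B})=\sup_{n\ge1}\frac{\mathbb{P}(X_1\in B_1,\dots,X_n\in B_n)}{\mathbb{P}(X_1\in B_1)\cdots\mathbb{P}(X_n\in B_n)}$, and for a collection $\mathcal{B}$ of such sequences, $\Theta(\mathrm{X},\mathcal{B})=\sup_{\mathrm{B}\in\mathcal{B}}\theta(\mathrm{X},\mathrm{B})$. Let $q_n=\lceil 1/r_n\rceil$ and, for $0\le k<q_n$, let $I_{n,k}$ be the image of $[k/q_n,(k+1)/q_n)$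 in $\mathbb{T}$; $\mathcal{B}(\mathrm{r})$ is the collection of all sequences $(I_{n,k_n})_{n\ge1}$ with integers $0\le k_n<q_n$. *)

(* Defs.v *)
From HB Require Import structures.
From mathcomp Require Import all_boot all_order all_algebra.
From mathcomp Require Import all_classical all_reals all_analysis.
Set Implicit Arguments. Unset Strict Implicit. Unset Printing Implicit Defensive.
Import Order.TTheory GRing.Theory Num.Theory numFieldNormedType.Exports.
Local Open Scope classical_set_scope.
Local Open Scope ring_scope.

(* The circle T = R/Z is represented by its lift to R: a real x stands for
   its class x + Z.  All notions below are Z-periodic, i.e. they only
   depend on classes mod 1. *)

Definition tdist (R : realType) (x y : R) : R :=
  Num.min `|x - y - (Num.floor (x - y))%:~R| `|x - y - (Num.floor (x - y) + 1)%:~R|.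

(* diameter (for the distance d) of a subset of T; diam of the empty set is 0 *)
Definition tdiam (R : realType) (U : set R) : R :=
  sup [set tdist xy.1 xy.2 | xy in U `*` U].

Definition gauge (R : realType) (g : R -> R) : Prop :=
  [/\ (forall x y : R, 0 <= x -> x <= y -> g x <= g y),
      (forall x : R, 0 <= x -> (g @ x^'+) --> g x),
      g 0 = 0 &
      (forall x : R, 0 < x -> g x != 0)].

Definition hcontent (R : realType) (g : R -> R) (delta : R) (E : set R) : \bar R :=
  ereal_inf [set (\sum_(0 <= i <oo) ((g (tdiam (U i)))%:E))%E
            | U in [set U : nat -> set R |
                      E `<=` \bigcup_i U i /\ (forall i, tdiam (U i) <= delta)]].

Definition hmeasure (R : realType) (g : R -> R) (E : set R) : \bar R :=
  ereal_sup [set hcontent g delta E | delta in [set delta : R | 0 < delta]].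

Definition qn (R : realType) (r : nat -> R) (n : nat) : int := Num.ceil (r n)^-1.

(* I_{n,k} = image in T of [k/q_n, (k+1)/q_n) (as a Z-periodic subset of R) *)
Definition Ink (R : realType) (r : nat -> R) (n : nat) (k : int) : set R :=
  [set x | exists m : int,
     (k%:~R / (qn r n)%:~R <= x - m%:~R) /\ (x - m%:~R < (k + 1)%:~R / (qn r n)%:~R)].

Definition Bcal (R : realType) (r : nat -> R) : set (nat -> set R) :=
  [set B | exists k : nat -> int,
     (forall n, 0 <= k n < qn r n) /\ B = (fun n => Ink r n (k n))].

(* theta(X,B) = sup_n P(X_1 in B_1,...,X_n in B_n) / prod_i P(X_i in B_i)
   (indices shifted to start at 0: n-th term uses X_0..X_n) *)
Definition theta (R : realType) (d : measure_display) (Omega : measurableType d)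
  (P : probability Omega R) (X : nat -> Omega -> R) (B : nat -> set R) : \bar R :=
  ereal_sup (range (fun n : nat =>
    (fine (P (\bigcap_(i in `I_n.+1) (X i @^-1` B i)))
       / \prod_(i < n.+1) fine (P (X i @^-1` B i)))%:E)).

Definition Theta (R : realType) (d : measure_display) (Omega : measurableType d)
  (P : probability Omega R) (X : nat -> Omega -> R) (BB : set (nat -> set R)) : \bar R :=
  ereal_sup [set theta P X B | B in BB].

Definition limsup_set (R : realType) (x : nat -> R) (r : nat -> R) : set R :=
  [set xi | forall N : nat, exists2 n : nat, (N <= n)%N & tdist xi (x n) < r n].

(* Main.v *)
Require Import Defs.
From HB Require Import structures.
From mathcomp Require Import all_boot all_order all_algebra.
From mathcomp Require Import all_classical all_reals all_analysis.
From mathcomp Require Import zify ring lra.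
Import Order.TTheory GRing.Theory Num.Theory numFieldNormedType.Exports.
Local Open Scope classical_set_scope.
Local Open Scope ring_scope.

(* The condition Theta < oo is only used through one consequence: if K_n is a
   set of intervals I_{n,k} and p_n = #K_n / q_n, then, summing over all
   choices of intervals, X_1, ..., X_M avoid K_1, ..., K_M with probability at
   most Theta * prod_n (1 - p_n), which tends to 0 when sum p_n = oo.

   For a piece E of G with H^g(E) > 0, let K_n be the set of the intervals of
   order n whose closure meets E in a set of positive H^g-measure.  The other
   intervals carry no Hausdorff content, so that #K_n * g(r_n) is bounded below
   and p_n >= c r_n / g(r_n).  Hence almost surely, for every E in the countable
   family of finite intersections of G with closed intervals and every N, some
   X_n with n >= N lies in an interval of K_n.  Shrinking E to its intersection
   with that closed interval and iterating gives a decreasing sequence of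
   nonempty compact subsets of G, whose common points belong to E(X, r).
   The strict inequality d(xi, X_n) < r_n holds because almost surely X_n is
   never an end point, which is a rational. *)

Set Implicit Arguments.
Unset Strict Implicit.

(** * Distance and diameter on the circle *)

Section Circle.
Context {R : realType}.
Implicit Types (x y z c : R) (U : set R).

Lemma tdist_le x y (m : int) : tdist x y <= `|x - y - m%:~R|.
Proof.
rewrite /tdist; set t := x - y.
have /andP[h1 h2] := floor_itv t; set f := Num.floor t in h1 h2 *.
rewrite ge_min; have [mf|fm] := leP m f.
  have : (m%:~R : R) <= f%:~R by rewrite ler_int.
  move=> ?; apply/orP; left; rewrite !ger0_norm; lra.
have : ((f + 1)%:~R : R) <= m%:~R by rewrite ler_int; lia.
move=> ?; apply/orP; right; rewrite !ler0_norm; lra.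
Qed.

Lemma tdist_attained x y : exists m : int, tdist x y = `|x - y - m%:~R|.
Proof. by rewrite /tdist minEle; case: ifP => _; eexists. Qed.

Lemma tdist_ge0 x y : 0 <= tdist x y.
Proof. by have [m ->] := tdist_attained x y. Qed.

Lemma tdistC x y : tdist x y = tdist y x.
Proof.
suff le (a b : R) : tdist a b <= tdist b a by apply/eqP; rewrite eq_le !le.
have [m ->] := tdist_attained b a.
have := tdist_le a b (- m); rewrite -normrN.
by have -> : - (a - b - (- m)%:~R) = b - a - m%:~R by rewrite mulrNz; ring.
Qed.

Lemma tdist_triangle y x z : tdist x z <= tdist x y + tdist y z.
Proof.
have [m ->] := tdist_attained x y; have [n ->] := tdist_attained y z.
apply: (le_trans (tdist_le x z (m + n))); apply: le_trans (ler_normD _ _).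
by rewrite (_ : x - y - m%:~R + _ = x - z - (m + n)%:~R)// intrD; ring.
Qed.

Lemma tdist_le_norm x y : tdist x y <= `|x - y|.
Proof. by have := tdist_le x y 0; rewrite subr0. Qed.

Lemma closed_tball c (e : R) : closed [set x | tdist x c <= e].
Proof.
rewrite -[X in closed X]setCK; apply: open_closedC; rewrite openE => x /= /negP.
rewrite -ltNge => xc; exists (tdist x c - e) => /=; first by rewrite subr_gt0.
move=> y /= xy; apply/negP; rewrite -ltNge.
have := tdist_triangle y x c; have := tdist_le_norm x y; lra.
Qed.

Lemma tdiam_le U (e : R) : 0 <= e ->
  (forall x y, U x -> U y -> tdist x y <= e) -> tdiam U <= e.
Proof.
move=> e0 Ue; rewrite /tdiam; set S := [set _ | _ in _].
have [->|S0] := eqVneq S set0; first by rewrite sup0.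
apply: ge_sup; first exact/set0P.
by move=> _ [[x y] [/= Ux Uy] <-]; exact: Ue.
Qed.

Lemma tdiam_ge0 U : 0 <= tdiam U.
Proof.
rewrite /tdiam; set S := [set _ | _ in _].
(* Without a supremum, in particular for empty [U], [sup] takes the default value 0. *)
have [[[z Sz] Sub]|/sup_out -> //] := pselect (has_sup S).
apply: le_trans (ub_le_sup Sub Sz).
by case: Sz => [[x y] _ <-]; exact: tdist_ge0.
Qed.

Lemma tdiam0 : tdiam (set0 : set R) = 0.
Proof. by apply/eqP; rewrite eq_le tdiam_ge0 andbT tdiam_le. Qed.

Lemma tdiam_tball U c (e : R) : 0 <= e ->
  U `<=` [set x | tdist x c <= e] -> tdiam U <= 2 * e.
Proof.
move=> e0 Ue; apply: tdiam_le => [|x y /Ue/= xc /Ue/= yc]; first lra.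
have := tdist_triangle c x y; rewrite (tdistC c y); lra.
Qed.

(* The closure of the image of [k/q, (k+1)/q), written as a closed ball. *)
Definition arc (q k : nat) : set R :=
  [set x | tdist x ((k%:R + 2^-1) / q%:R) <= 2^-1 / q%:R].

End Circle.

(** * Hausdorff content: finite subadditivity and positivity *)

Section HausdorffContent.
Context {R : realType}.
Variable g : R -> R.
Hypothesis gaugeg : gauge g.
Implicit Types (E F U : set R) (delta : R).

Lemma gauge_le (x y : R) : 0 <= x -> x <= y -> g x <= g y.
Proof. by case: gaugeg => h _ _ _; exact: h. Qed.

Lemma gauge_ge0 (x : R) : 0 <= x -> 0 <= g x.
Proof. by case: gaugeg => h _ g0 _ x0; rewrite -g0 h. Qed.

Lemma gauge_gt0 (x : R) : 0 < x -> 0 < g x.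
Proof. by case: gaugeg => _ _ _ g0 x0; rewrite lt_def g0//= gauge_ge0// ltW. Qed.

Let gE_ge0 (U : nat -> set R) (i : nat) : (0 <= (g (tdiam (U i)))%:E)%E.
Proof. by rewrite lee_fin gauge_ge0// tdiam_ge0. Qed.

Lemma hcontent_ge0 delta E : (0 <= hcontent g delta E)%E.
Proof.
by apply: le_ereal_inf_tmp => _ [U _ <-]; apply: nneseries_ge0 => i _ _.
Qed.

Lemma hcontent_le delta E (U : nat -> set R) : E `<=` \bigcup_i U i ->
  (forall i, tdiam (U i) <= delta) ->
  (hcontent g delta E <= \sum_(0 <= i <oo) (g (tdiam (U i)))%:E)%E.
Proof. by move=> EU Ud; apply: ereal_inf_lbound; exists U. Qed.

Lemma hcontent_cover delta E (a : \bar R) : (hcontent g delta E < a)%E ->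
  exists U : nat -> set R, [/\ E `<=` \bigcup_i U i,
    forall i, tdiam (U i) <= delta &
    (\sum_(0 <= i <oo) (g (tdiam (U i)))%:E < a)%E].
Proof. by move=> /ereal_inf_lt[_ [U [EU Ud] <-] Ua]; exists U. Qed.

Lemma hcontent_le1 delta E : tdiam E <= delta ->
  (hcontent g delta E <= (g (tdiam E))%:E)%E.
Proof.
(* Padding the one-set cover with empty sets is free, since [g 0 = 0]. *)
move=> Ed; pose U (i : nat) := if i == 0%N then E else set0.
have := @hcontent_le delta E U; rewrite (nneseries_split 0 1)//= add0n.
rewrite [X in (_ + X)%E]eseries0; last first.
  by case=> // i _ _; rewrite /U/= tdiam0; case: gaugeg => _ _ ->.
rewrite adde0 big_nat1; apply; first by move=> x Ex; exists 0%N.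
by case=> // i; rewrite /U/= tdiam0 (le_trans _ Ed)// tdiam_ge0.
Qed.

Lemma hcontent0 delta : 0 <= delta -> hcontent g delta set0 = 0%E.
Proof.
move=> d0; apply/eqP; rewrite eq_le hcontent_ge0 andbT.
have := @hcontent_le1 delta set0; rewrite tdiam0.
by case: gaugeg => _ _ -> _; apply.
Qed.

(** The first [2m] interleaved terms are the first [m] of each series, and every partial sum is
    below one of even length. This prices the merging of two covers into one sequence. *)
Lemma nneseries_interleave (u v : nat -> \bar R) :
  (forall i, 0 <= u i)%E -> (forall i, 0 <= v i)%E ->
  (\sum_(0 <= i <oo) (if odd i then v i./2 else u i./2) <=
   \sum_(0 <= i <oo) u i + \sum_(0 <= i <oo) v i)%E.
Proof.
move=> u0 v0; pose w i := if odd i then v i./2 else u i./2.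
rewrite -[leLHS]/(\sum_(0 <= i <oo) w i)%E.
have w0 i : (0 <= w i)%E by rewrite /w; case: ifP.
apply: lime_le; first exact: is_cvg_nneseries.
apply: nearW => n.
have wE m : (\sum_(0 <= i < m.*2) w i =
    \sum_(0 <= i < m) u i + \sum_(0 <= i < m) v i)%E.
  elim: m => [|m IH]; first by rewrite !big_geq// adde0.
  rewrite doubleS !big_nat_recr//= IH /w /= odd_double/= doubleK uphalf_double.
  by rewrite -!addeA; congr (_ + _)%E; rewrite addeCA.
apply: (@le_trans _ _ (\sum_(0 <= i < n.*2) w i)%E).
  rewrite [leRHS](@big_cat_nat _ _ _ n)//= -?addnn ?leq_addr//.
  by rewrite leeDl// sume_ge0.
by rewrite wE leeD// nneseries_lim_ge.
Qed.

(** Covers within [e / 2] of each infimum, taken alternately, cover the union; an infinite content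
    is settled first. *)
Lemma hcontentU delta E F :
  (hcontent g delta (E `|` F) <= hcontent g delta E + hcontent g delta F)%E.
Proof.
have [E0 F0] := (hcontent_ge0 delta E, hcontent_ge0 delta F).
have [->|Eoo] := eqVneq (hcontent g delta E) +oo%E.
  by rewrite addye ?leey// gt_eqF// (lt_le_trans _ F0).
have [->|Foo] := eqVneq (hcontent g delta F) +oo%E.
  by rewrite addey ?leey// gt_eqF// (lt_le_trans _ E0).
have Efin : hcontent g delta E \is a fin_num.
  by rewrite ge0_fin_numE// ltey.
have Ffin : hcontent g delta F \is a fin_num.
  by rewrite ge0_fin_numE// ltey.
apply/lee_addgt0Pr => e e0.
have e2 : (0 < (e / 2)%:E)%E by rewrite lte_fin divr_gt0.
have [|U [EU Ud Us]] := @hcontent_cover delta E (hcontent g delta E + (e / 2)%:E).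
  by rewrite lteDl.
have [|V [FV Vd Vs]] := @hcontent_cover delta F (hcontent g delta F + (e / 2)%:E).
  by rewrite lteDl.
pose W i := if odd i then V i./2 else U i./2.
apply: (@le_trans _ _ (\sum_(0 <= i <oo) (g (tdiam (W i)))%:E)%E).
  apply: hcontent_le => [x [/EU[i _ Ui]|/FV[i _ Vi]]|i].
  - by exists i.*2 => //; rewrite /W odd_double doubleK.
  - by exists i.*2.+1 => //; rewrite /W /= odd_double uphalf_double.
  - by rewrite /W; case: ifP.
rewrite (eq_eseriesr (g := fun i => if odd i then (g (tdiam (V i./2)))%:E
    else (g (tdiam (U i./2)))%:E)); last by move=> i _; rewrite /W; case: ifP.
apply: (le_trans (nneseries_interleave (gE_ge0 U) (gE_ge0 V))).
rewrite (_ : e%:E = (e / 2)%:E + (e / 2)%:E)%E; last by rewrite -EFinD -splitr.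
by rewrite addeACA leeD// ltW.
Qed.

Lemma hcontent_bigcup delta (q : nat) (E : nat -> set R) : 0 <= delta ->
  (hcontent g delta (\bigcup_(k in `I_q) E k) <=
   \sum_(0 <= k < q) hcontent g delta (E k))%E.
Proof.
move=> d0; elim: q => [|q IH].
  by rewrite II0 bigcup_set0 hcontent0// big_geq.
rewrite IIS bigcup_setU bigcup_set1 big_nat_recr//=.
by rewrite (le_trans (hcontentU _ _ _))// leeD2r.
Qed.

Lemma hmeasure_gt0P E :
  (0 < hmeasure g E)%E <-> exists2 delta, 0 < delta & (0 < hcontent g delta E)%E.
Proof.
split=> [/ereal_sup_gt[_ [delta d0 <-] h]|[delta d0 h]]; first by exists delta.
by apply: lt_le_trans h _; apply: ereal_sup_ubound; exists delta.
Qed.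

Lemma hmeasure_gt0_nonempty E : (0 < hmeasure g E)%E -> E !=set0.
Proof.
move=> /hmeasure_gt0P[delta d0]; have [->|/set0P//] := eqVneq E set0.
by rewrite hcontent0 ?ltxx// ltW.
Qed.

(** The measure is the supremum of the contents over all scales, so a null set can be discarded at
    any fixed scale. *)
Lemma hmeasure_eq0 delta E : 0 < delta -> ~~ (0 < hmeasure g E)%E ->
  hcontent g delta E = 0%E.
Proof.
move=> d0 E0; apply/eqP; rewrite eq_le hcontent_ge0 andbT leNgt.
by apply: contra E0 => h; apply/hmeasure_gt0P; exists delta.
Qed.

End HausdorffContent.

(** * The intervals of order [n] and their closures *)

Section Intervals.
Context {R : realType}.
Variable r : nat -> R.
Hypothesis r01 : forall n, 0 < r n <= 1.
Implicit Types (n k : nat) (x : R).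

Definition qN n : nat := `|qn r n|%N.

Lemma qN_int n : qn r n = (qN n)%:Z.
Proof.
rewrite /qN gez0_abs// /qn; apply/ltW; rewrite ceil_gt0 invr_gt0.
by case/andP: (r01 n).
Qed.

Lemma qN_gt0 n : (0 < qN n)%N.
Proof.
rewrite -ltz_nat -qN_int /qn ceil_gt0 invr_gt0.
by case/andP: (r01 n).
Qed.

Lemma qNV_gt0 n : 0 < (qN n)%:R^-1 :> R.
Proof. by rewrite invr_gt0 ltr0n qN_gt0. Qed.

Lemma qNV_le n : (qN n)%:R^-1 <= r n.
Proof.
have /andP[r0 _] := r01 n.
rewrite -[leRHS]invrK lef_pV2 ?posrE ?ltr0n ?qN_gt0 ?invr_gt0//.
by have := ceil_ge (r n)^-1; rewrite -/(qn r n) qN_int.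
Qed.

(** The ceiling is below [1/r + 1], which is at most [2/r] because [r <= 1]. *)
Lemma qNV_ge n : r n / 2 <= (qN n)%:R^-1.
Proof.
have /andP[r0 r1] := r01 n.
have /andP[+ _] := ceil_itv (r n)^-1; rewrite -/(qn r n) qN_int intrB => h.
have r1' : 1 <= (r n)^-1 by rewrite -invr1 lef_pV2 ?posrE.
have -> : r n / 2 = (2 * (r n)^-1)^-1 by field; rewrite gt_eqF.
rewrite lef_pV2 ?posrE ?ltr0n ?qN_gt0 ?mulr_gt0 ?invr_gt0//.
by rewrite -pmulrn in h; lra.
Qed.

Lemma InkE n k : Ink r n k = \bigcup_(m : int)
  `[m%:~R + k%:R / (qN n)%:R, m%:~R + k.+1%:R / (qN n)%:R[%classic.
Proof.
rewrite /Ink qN_int intrD -!pmulrn natr1.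
apply/seteqP; split=> x /= [m]; last first.
  by move=> _; rewrite /= in_itv/= => /andP[h1 h2]; exists m; split; lra.
by move=> [h1 h2]; exists m => //=; rewrite in_itv/=; apply/andP; split; lra.
Qed.

Lemma measurable_Ink n k : measurable (Ink r n k).
Proof.
rewrite InkE; apply: countable_bigcupT_measurable => [|m].
  exact: countableP.
exact: measurable_itv.
Qed.

Lemma Ink_unit n k : (k < qN n)%N -> Ink r n k `&` `[0, 1[ =
  `[k%:R / (qN n)%:R, k.+1%:R / (qN n)%:R[%classic.
Proof.
move=> kq; have q0 : 0 < (qN n)%:R :> R by rewrite ltr0n qN_gt0.
have k0 : 0 <= k%:R / (qN n)%:R :> R by rewrite divr_ge0.
have k1 : k.+1%:R / (qN n)%:R <= 1 :> R by rewrite ler_pdivrMr// mul1r ler_nat.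
rewrite InkE; apply/seteqP; split=> x /=; rewrite !in_itv/=; last first.
  move=> /andP[h1 h2]; split; last by apply/andP; split; lra.
  by exists 0 => //=; rewrite in_itv/= !add0r h1.
move=> [[m _]]; rewrite /= in_itv/= => /andP[h1 h2] /andP[h3 h4].
(* As [k < q], only the translate by 0 meets the unit interval. *)
suff m0 : m = 0 by rewrite m0 !add0r in h1 h2; rewrite h1.
have m1 : m < 1 by rewrite -(ltr_int R); lra.
have m2 : -1 < m by rewrite -(ltr_int R) mulrNz; lra.
lia.
Qed.

Lemma lebesgue_Ink n k : (k < qN n)%N ->
  lebesgue_measure (Ink r n k `&` `[0, 1[) = ((qN n)%:R^-1)%:E.
Proof.
move=> kq; rewrite Ink_unit// lebesgue_measure_itv/= lte_fin.
rewrite ltr_pM2r ?qNV_gt0// ltr_nat ltnSn -EFinB; congr EFin.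
by rewrite -natr1 mulrDl mul1r [X in X - _]addrC addrK.
Qed.

Lemma Ink_cover n x : exists2 k, (k < qN n)%N & Ink r n k x.
Proof.
have q0 : 0 < (qN n)%:R :> R by rewrite ltr0n qN_gt0.
have /andP[f1 f2] := floor_itv x; set f := Num.floor x in f1 f2.
rewrite intrD in f2.
(* The index sought is the integer part of [q] times the fractional part of [x]. *)
set t := (qN n)%:R * (x - f%:~R).
have t0 : 0 <= t by apply: mulr_ge0; [exact: ltW|lra].
have /andP[k1 k2] := Num.Theory.truncn_itv t0; set k := Num.trunc t in k1 k2.
have tq : t < (qN n)%:R by rewrite /t -[ltRHS]mulr1 ltr_pM2l//; lra.
exists k; first by rewrite -(ltr_nat R) (le_lt_trans k1).
rewrite InkE; exists f => //=; rewrite in_itv/=.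
have -> : x = f%:~R + t / (qN n)%:R by rewrite /t; field; rewrite gt_eqF.
by rewrite lerD2l ltrD2l ler_pM2r ?ltr_pM2r ?invr_gt0// k1.
Qed.

(** The reference point is the midpoint of the interval. Half the length can be attained only at the
    left end point, which is rational. *)
Lemma Ink_tdist n k x : Ink r n k x ->
  tdist x ((k%:R + 2^-1) / (qN n)%:R) <= 2^-1 / (qN n)%:R /\
  (~ rational x ->
   tdist x ((k%:R + 2^-1) / (qN n)%:R) < 2^-1 / (qN n)%:R).
Proof.
rewrite InkE => -[m _]; rewrite /= in_itv/= -natr1 => /andP[h1 h2].
have qV := qNV_gt0 n; have := tdist_le x ((k%:R + 2^-1) / (qN n)%:R) m.
move: h1 h2; rewrite !mulrDl mul1r => h1 h2 h3; split.
  apply: (le_trans h3); rewrite ler_norml; apply/andP; split; lra.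
move=> irr; apply: (le_lt_trans h3); rewrite ltr_norml; apply/andP; split.
  have : m%:~R + k%:R / (qN n)%:R != x.
    apply/eqP => xE; apply: irr; rewrite /rational/=.
    exists (m%:~R + k%:R / (qN n)%:R) => //.
    by rewrite rmorphD/= fmorph_div/= !ratr_nat ratr_int.
  rewrite neq_lt => /orP[|]; lra.
lra.
Qed.

Lemma arc_cover n : \bigcup_(k in `I_(qN n)) arc (qN n) k = setT :> set R.
Proof.
apply/seteqP; split=> // x _; have [k kq /Ink_tdist[xk _]] := Ink_cover n x.
by exists k.
Qed.

(** Both points lie within [1/(2q)] of the midpoint, [x] strictly so, and [1/q <= r n]. *)
Lemma arc_Ink_tdist n k x y : ~ rational x -> Ink r n k x -> arc (qN n) k y ->
  tdist y x < r n.
Proof.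
move=> irr /Ink_tdist[_ /(_ irr) xk]; rewrite /arc/= => yk.
apply: lt_le_trans (qNV_le n).
apply: (le_lt_trans (tdist_triangle ((k%:R + 2^-1) / (qN n)%:R) _ _)).
by rewrite (tdistC _ x); lra.
Qed.

End Intervals.

(** * Proportion of arcs carrying positive measure *)

Section HeavyArcs.
Context {R : realType}.
Variables (r : nat -> R) (g : R -> R).
Hypothesis r01 : forall n, 0 < r n <= 1.
Hypothesis gaugeg : gauge g.
Implicit Types (E : set R) (n k : nat).

Definition heavy E n k : bool := (0 < hmeasure g (E `&` arc (qN r n) k))%E.

(** An arc that is not heavy has content 0; a heavy one is covered by itself, with diameter at most
    [1/q <= r n]. *)
Lemma hcontent_arc delta E n k : r n <= delta ->
  (hcontent g delta (E `&` arc (qN r n) k) <= ((heavy E n k)%:R * g (r n))%:E)%E.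
Proof.
move=> rd; have /andP[r0 _] := r01 n.
have [h|h] := boolP (heavy E n k); last first.
  by rewrite mul0r (hmeasure_eq0 gaugeg _ h)// (lt_le_trans r0).
rewrite mul1r.
have tr : tdiam (E `&` arc (qN r n) k) <= r n.
  apply: le_trans (qNV_le r01 n).
  rewrite (_ : _^-1 = 2 * (2^-1 / (qN r n)%:R)); last by rewrite mulrA divff ?mul1r// pnatr_eq0.
  by apply: tdiam_tball; [rewrite divr_ge0|apply: subIsetr].
apply: (le_trans (hcontent_le1 gaugeg (le_trans tr rd))).
by rewrite lee_fin gauge_le// tdiam_ge0.
Qed.

Lemma hcontent_le_heavy delta E n : r n <= delta ->
  (hcontent g delta E <= ((\sum_(0 <= k < qN r n) (heavy E n k)%:R) * g (r n))%:E)%E.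
Proof.
move=> rd; have /andP[r0 _] := r01 n.
rewrite -[E in leLHS]setIT -(arc_cover r01 n) setI_bigcupr.
apply: (le_trans (hcontent_bigcup gaugeg _ _ (le_trans (ltW r0) rd))).
rewrite mulr_suml -sumEFin; apply: lee_sum => k _; exact: hcontent_arc.
Qed.

(** If no arc were heavy, subadditivity would make the content of [E] vanish at every scale. *)
Lemma heavy_exists E n : (0 < hmeasure g E)%E ->
  1 <= \sum_(0 <= k < qN r n) (heavy E n k)%:R :> R.
Proof.
move=> E0; rewrite -natr_sum ler1n lt0n; apply/negP => /eqP s0.
have nh k : (k < qN r n)%N -> ~~ heavy E n k.
  move=> kq; apply/negP => h; move: s0; rewrite big_mkord.
  by rewrite (bigD1 (Ordinal kq))//= h.
move/(hmeasure_gt0P g) : E0 => [delta d0]; rewrite ltNge => /negP; apply.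
rewrite -[E]setIT -(arc_cover r01 n) setI_bigcupr.
apply: (le_trans (hcontent_bigcup gaugeg _ _ (ltW d0))).
rewrite big_nat big1// => k /andP[_ kq].
by rewrite (hmeasure_eq0 gaugeg d0)// nh.
Qed.

Lemma heavy_proportion E : (0 < hmeasure g E)%E -> exists2 c : R, 0 < c &
  forall n, c * (r n / g (r n)) <=
    (\sum_(0 <= k < qN r n) (heavy E n k)%:R) / (qN r n)%:R.
Proof.
move=> E0; have [delta d0 h0] := (hmeasure_gt0P g E).1 E0.
(* The content may be infinite, hence a finite lower bound [b]. *)
have [b b0 bE] : exists2 b : R, 0 < b & (b%:E <= hcontent g delta E)%E.
  move: h0; case: (hcontent g delta E) => [b b0||//]; first by exists b.
  by exists 1; rewrite ?leey.
have gd := gauge_gt0 gaugeg d0.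
(* [b] serves when [r n <= delta], by counting content; [g delta] serves when [r n > delta], where
   one heavy arc is enough; the factor 2 comes from [qNV_ge]. *)
exists (Num.min b (g delta) / 2) => [|n]; first by rewrite divr_gt0// lt_min b0.
have /andP[r0 _] := r01 n; have gr := gauge_gt0 gaugeg r0.
set H := \sum_(_ <= _ < _) _.
have H1 : 1 <= H := heavy_exists n E0.
apply: (@le_trans _ _ (H * (r n / 2))); last first.
  by rewrite ler_wpM2l ?qNV_ge//; lra.
rewrite (_ : _ / 2 * _ = Num.min b (g delta) / g (r n) * (r n / 2)); last by field; rewrite gt_eqF.
rewrite ler_pM2r ?divr_gt0// ler_pdivrMr//.
have [rd|dr] := leP (r n) delta.
  rewrite ge_min; apply/orP; left; rewrite -lee_fin.
  exact: le_trans bE (hcontent_le_heavy _ rd).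
rewrite ge_min; apply/orP; right.
apply: (@le_trans _ _ (g (r n))); first by rewrite gauge_le// ltW.
by rewrite ler_peMl// ltW.
Qed.

End HeavyArcs.

(** * Decay of products and divergence of tails *)

Section Products.
Context {R : realType}.

(** Inductively, [(1 - a)(1 + s + a) <= 1 + s] for [a, s >= 0]. A large sum thus forces a small
    product. *)
Lemma prod_onem_le (a : nat -> R) (M : nat) : (forall i, 0 <= a i <= 1) ->
  (\prod_(i < M) (1 - a i)) * (1 + \sum_(i < M) a i) <= 1.
Proof.
move=> a01; elim: M => [|M IH]; first by rewrite !big_ord0 mul1r addr0.
rewrite !big_ord_recr/=; have /andP[a0 a1] := a01 M.
have s0 : 0 <= \sum_(i < M) a i by apply: sumr_ge0 => i _; case/andP: (a01 i).
have p0 : 0 <= \prod_(i < M) (1 - a i).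
  by apply: prodr_ge0 => i _; rewrite subr_ge0; case/andP: (a01 i).
apply: le_trans IH; rewrite -mulrA ler_wpM2l//; nra.
Qed.

Lemma nneseries_tail_unbounded (u : nat -> R) (N : nat) (B : R) :
  (forall i, 0 <= u i) -> (\sum_(0 <= i <oo) (u i)%:E = +oo)%E ->
  exists M, B < \sum_(N <= i < M) u i.
Proof.
move=> u0 uoo; apply: contrapT => /forallNP h.
suff : (\sum_(0 <= i <oo) (u i)%:E < +oo)%E by rewrite uoo.
rewrite (nneseries_split 0 N) ?add0n => [|i _]; last by rewrite lee_fin.
rewrite sumEFin lte_add_pinfty ?ltry//; apply: (@le_lt_trans _ _ B%:E); last exact: ltry.
apply: lime_le; first by apply: is_cvg_nneseries => i _ _; rewrite lee_fin.
by apply: nearW => M; rewrite sumEFin lee_fin leNgt; apply/negP/h.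
Qed.

End Products.

(** * Finite subadditivity and countable unions of null sets *)

Section Measure.

Lemma measure_subadditive_fin (d : measure_display) (T : measurableType d)
    (R : realType) (mu : {measure set T -> \bar R}) (I : finType) (Q : pred I)
    (A : set T) (F : I -> set T) :
  measurable A -> (forall i, measurable (F i)) ->
  (forall x, A x -> exists2 i, Q i & F i x) ->
  (mu A <= \sum_(i | Q i) mu (F i))%E.
Proof.
move=> mA mF AF.
have mU (s : seq I) : measurable (\big[setU/set0]_(i <- s | Q i) F i).
  exact: bigsetU_measurable.
apply: (@le_trans _ _ (mu (\big[setU/set0]_(i | Q i) F i))).
  apply: le_measure; rewrite ?inE// => x /AF[i Qi Fx].
  by rewrite -bigcup_seq_cond; exists i; rewrite //= mem_index_enum.
elim: (index_enum I) => [|i s IH]; first by rewrite !big_nil measure0.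
rewrite !big_cons; case: ifP => // _.
by apply: (le_trans (measureU2 _ (mF i) (mU s))); rewrite leeD2l.
Qed.

Lemma negligible_bigcup_countable (d : measure_display) (T : measurableType d)
    (R : realType) (mu : {measure set T -> \bar R}) (I : countType)
    (F : I -> set T) :
  (forall i, mu.-negligible (F i)) -> mu.-negligible (\bigcup_i F i).
Proof.
move=> F0; pose F' n := if unpickle n is Some i then F i else set0.
apply: (@negligibleS _ _ _ _ (\bigcup_n F' n)).
  by move=> x [i _ Fix]; exists (pickle i) => //; rewrite /F' pickleK.
apply: negligible_bigcup => n; rewrite /F'; case: unpickle => [//|].
exact: negligible_set0.
Qed.

End Measure.

(** * Probability of avoiding prescribed intervals *)

Section Probability.
Context {R : realType} {d : measure_display} {Omega : measurableType d}.
Variables (P : probability Omega R) (X : nat -> Omega -> R) (r : nat -> R).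
Hypothesis mX : forall n, measurable_fun setT (X n).
Hypothesis unifX : forall n (A : set R), measurable A ->
  P (X n @^-1` A) = lebesgue_measure (A `&` `[0%R, 1%R[).
Hypothesis r01 : forall n, 0 < r n <= 1.

Let mXInk i (k : nat) : measurable (X i @^-1` Ink r i k).
Proof.
rewrite -[X in measurable X]setTI; apply: mX => //; exact: measurable_Ink.
Qed.

Lemma negligible_rational : P.-negligible (\bigcup_n X n @^-1` rational).
Proof.
have crat : countable (@rational R).
  rewrite /rational; apply: (sub_countable (card_image_le _ _)); exact: countableP.
have mrat : measurable (@rational R).
  apply: countable_measurable crat => t; exact: measurable_set1.
apply: negligible_bigcup => n; exists (X n @^-1` rational); split => //.
  by rewrite -[X in measurable X]setTI; apply: mX.
apply: (etrans (unifX n mrat)); apply: countable_lebesgue_measure0.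
by apply: sub_countable crat; apply: subset_card_le; apply: subIsetl.
Qed.

Lemma Theta_bound : (Theta P X (Bcal r) < +oo)%E -> exists2 C : R, 0 <= C &
  forall (M : nat) (k : nat -> nat), (forall i, (i < M)%N -> (k i < qN r i)%N) ->
  (P (\bigcap_(i in `I_M) X i @^-1` Ink r i (k i)) <=
     (C * \prod_(i < M) (qN r i)%:R^-1)%:E)%E.
Proof.
move=> Too; have [C0 TC] : exists C0 : R, (Theta P X (Bcal r) <= C0%:E)%E.
  by move: Too; case: Theta => [c _|//|_]; [exists c|exists 0; rewrite leNye].
(* The 1 covers [M = 0], a case absent from [theta], whose first term already involves [X 0]. *)
exists (Num.max 1 C0) => [|M k kq]; first by rewrite le_max ler01.
have mI M' (k' : nat -> nat) :
    measurable (\bigcap_(i in `I_M') X i @^-1` Ink r i (k' i)).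
  by apply: bigcap_measurableType => i _; exact: mXInk.
case: M => [|M] in kq *.
  rewrite big_ord0 mulr1; apply: le_trans (probability_le1 _ (mI _ _)) _.
  by rewrite lee_fin le_max lexx.
(* Members of [Bcal] are infinite sequences, so the choice is completed by index 0. *)
pose k' i := if (i < M.+1)%N then k i else 0%N.
have k'q i : (k' i < qN r i)%N.
  by rewrite /k'; case: ifP => [/kq//|_]; exact: qN_gt0.
pose B i := Ink r i (k' i).
have BB : Bcal r B.
  by exists (fun i => (k' i)%:Z); split=> // i; rewrite qN_int// ltz_nat k'q.
have -> : \bigcap_(i in `I_M.+1) X i @^-1` Ink r i (k i) =
    \bigcap_(i in `I_M.+1) X i @^-1` B i.
  by apply: eq_bigcapr => i /= iM; rewrite /B /k' iM.
have PB i : P (X i @^-1` B i) = ((qN r i)%:R^-1)%:E.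
  rewrite unifX; last exact: measurable_Ink.
  by rewrite lebesgue_Ink.
set p := P _; have pfin : p \is a fin_num.
  by apply: fin_num_measure; exact: (mI M.+1 k').
have : (theta P X B <= C0%:E)%E.
  by apply: le_trans TC; apply: ereal_sup_ubound; exists B.
have : ((fine p / \prod_(i < M.+1) fine (P (X i @^-1` B i)))%:E <= theta P X B)%E.
  by apply: ereal_sup_ubound; exists M.
move=> /le_trans h /h; rewrite lee_fin.
under eq_bigr do rewrite PB/=.
have prod0 : 0 < \prod_(i < M.+1) (qN r i)%:R^-1 :> R.
  by apply: prodr_gt0 => i _; exact: qNV_gt0.
rewrite ler_pdivrMr// -[p in (p <= _)%E]fineK// lee_fin => /le_trans; apply.
by rewrite ler_pM2r// le_max lexx orbT.
Qed.

Variable C : R.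
Hypothesis C0 : 0 <= C.
Hypothesis PC : forall (M : nat) (k : nat -> nat),
  (forall i, (i < M)%N -> (k i < qN r i)%N) ->
  (P (\bigcap_(i in `I_M) X i @^-1` Ink r i (k i)) <=
     (C * \prod_(i < M) (qN r i)%:R^-1)%:E)%E.

Definition allowed (L : nat -> nat -> bool) (i : nat) : set R :=
  \bigcup_(k in [set k | (k < qN r i)%N && L i k]) Ink r i k.

Lemma measurable_allowed L (M : nat) :
  measurable (\bigcap_(i in `I_M) X i @^-1` allowed L i).
Proof.
apply: bigcap_measurableType => i _.
rewrite -[X in measurable X]setTI; apply: mX => //.
by apply: bigcup_measurable => k _; exact: measurable_Ink.
Qed.

(** A union bound over all ways to pick one permitted interval per index: each costs [C] times the
    product of the [1/q], and the number of ways is the product of the counts. *)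
Lemma prob_allowed_le L (M : nat) :
  (P (\bigcap_(i in `I_M) X i @^-1` allowed L i) <=
   (C * \prod_(i < M) ((\sum_(0 <= k < qN r i) (L i k)%:R) / (qN r i)%:R))%:E)%E.
Proof.
(* A common bound on the indices, so that choices form a finite function type. *)
pose Q := (\max_(i < M) qN r i).+1.
have qQ (i : 'I_M) : (qN r i < Q)%N by rewrite ltnS; exact: leq_bigmax.
pose F (i : 'I_M) : pred 'I_Q := [pred k : 'I_Q | (k < qN r i)%N && L i k].
pose kf (f : {ffun 'I_M -> 'I_Q}) (i : nat) : nat :=
  if insub i is Some j then f j else 0%N.
have kfE f (i : 'I_M) : kf f i = f i by rewrite /kf valK.
pose E f := \bigcap_(i in `I_M) X i @^-1` Ink r i (kf f i).
have mE f : measurable (E f).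
  by apply: bigcap_measurableType => i _; exact: mXInk.
apply: (@le_trans _ _ (\sum_(f in family F) P (E f))%E).
  apply: measure_subadditive_fin => // [|w Aw]; first exact: measurable_allowed.
  have /fin_all_exists[f fP] (i : 'I_M) : exists k : 'I_Q, F i k /\ Ink r i k (X i w).
    have [k /andP[/= kq Lk] Xk] := Aw i (ltn_ord i).
    by exists (Ordinal (ltn_trans kq (qQ i))); split=> //; apply/andP.
  exists (finfun f); first by apply/familyP => i; rewrite ffunE; case: (fP i).
  move=> i /= iM; rewrite (kfE _ (Ordinal iM)) ffunE.
  by case: (fP (Ordinal iM)).
apply: (@le_trans _ _ (\sum_(f in family F) (C * \prod_(i < M) (qN r i)%:R^-1)%:E)%E).
  apply: lee_sum => f /familyP fF; apply: PC => i iM.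
  by rewrite (kfE _ (Ordinal iM)); case/andP: (fF (Ordinal iM)).
rewrite sumEFin lee_fin -mulr_sumr ler_wpM2l//.
(* Distributivity turns the sum over choices into a product of sums. *)
rewrite -(bigA_distr_big_dep F (fun (i : 'I_M) (_ : 'I_Q) => (qN r i)%:R^-1)).
apply: ler_prod => i _; apply/andP; split; first exact: sumr_ge0.
rewrite mulr_suml big_mkord (big_ord_widen Q (fun k => (L i k)%:R / _)) ?(ltnW (qQ i))//.
rewrite [leLHS]big_mkcond [leRHS]big_mkcond/=; apply: ler_sum => k _.
by rewrite /F/=; case: (k < _)%N; case: (L i k); rewrite /= ?mul1r ?mul0r.
Qed.

Lemma negligible_avoid (K : nat -> nat -> bool) :
  (forall B : R, exists M : nat,
     B < \sum_(i < M) ((\sum_(0 <= k < qN r i) (K i k)%:R) / (qN r i)%:R)) ->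
  P.-negligible [set w | forall i k, (k < qN r i)%N -> K i k ->
                           ~ Ink r i k (X i w)].
Proof.
move=> Koo; pose a i : R := (\sum_(0 <= k < qN r i) (K i k)%:R) / (qN r i)%:R.
have {}Koo (B : R) : exists M : nat, B < \sum_(i < M) a i by exact: Koo.
pose L i k := ~~ K i k.
pose A M := \bigcap_(i in `I_M) X i @^-1` allowed L i.
have qn0 i : (qN r i)%:R != 0 :> R by rewrite pnatr_eq0 -lt0n qN_gt0.
have LE i : (\sum_(0 <= k < qN r i) (L i k)%:R) / (qN r i)%:R = 1 - a i.
  apply/eqP; rewrite eq_sym subr_eq /a -mulrDl -big_split/=.
  rewrite (eq_bigr (fun=> 1)) => [|k _]; last by rewrite /L; case: (K i k); rewrite ?addr0 ?add0r.
  by rewrite big_mkord sumr_const card_ord divff.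
have a01 i : 0 <= a i <= 1.
  apply/andP; split; first by rewrite divr_ge0// sumr_ge0.
  by rewrite -subr_ge0 -LE divr_ge0// sumr_ge0.
have mA : measurable (\bigcap_M A M).
  by apply: bigcapT_measurable => M; exact: measurable_allowed.
exists (\bigcap_M A M); split => //; last first.
  move=> w wK M _ i _; have [k kq Xk] := Ink_cover r01 i (X i w).
  exists k => //=; rewrite kq /L; apply/negP => Kk; exact: wK Xk.
have pfin : P (\bigcap_M A M) \is a fin_num by apply: fin_num_measure.
apply/eqP; rewrite eq_le measure_ge0 andbT leNgt; apply/negP.
rewrite -(fineK pfin) lte_fin => p0; set p := fine _ in p0.
(* If the probability [p] were positive, a sum [S > C / p] would contradict [p * (1 + S) <= C]. *)
have [M] := Koo (C / p); rewrite ltr_pdivrMr// => CM.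
have pM : p <= C * \prod_(i < M) (1 - a i).
  rewrite -lee_fin fineK//; under eq_bigr do rewrite -LE.
  apply: le_trans (prob_allowed_le L M); apply: le_measure; rewrite ?inE//.
    exact: measurable_allowed.
  exact: bigcap_inf.
have := prod_onem_le M a01; set S := \sum_(i < M) a i in CM *.
set Pi := \prod_(i < M) (1 - a i) in pM * => PS.
have S0 : 0 <= S by apply: sumr_ge0 => i _; case/andP: (a01 i).
have : p * (1 + S) <= C * Pi * (1 + S) by rewrite ler_wpM2r// addr_ge0.
have : C * (Pi * (1 + S)) <= C * 1 by rewrite ler_wpM2l.
lra.
Qed.

End Probability.

(** * Nested compact pieces and their common point *)

Section NestedArcs.
Context {R : realType}.
Variables (r : nat -> R) (g : R -> R) (G : set R).
Hypothesis r01 : forall n, 0 < r n <= 1.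
Hypothesis gaugeg : gauge g.
Hypothesis cG : compact G.
Hypothesis G0 : (0 < hmeasure g G)%E.

(** Indexing by finite lists keeps the family countable, so that one null event can be discarded for
    each piece. *)
Fixpoint piece (s : seq (nat * nat)) : set R :=
  if s is (n, k) :: s' then piece s' `&` arc (qN r n) k else G.

Lemma piece_sub s : piece s `<=` G.
Proof. by elim: s => [|[n k] s IH] //= x [/IH]. Qed.

Lemma nested_hits (x : nat -> R) : (forall n, ~ rational (x n)) ->
  (forall s N, (0 < hmeasure g (piece s))%E -> exists n k,
     [/\ (N <= n)%N, heavy r g (piece s) n k & Ink r n k (x n)]) ->
  limsup_set x r `&` G !=set0.
Proof.
move=> irr hit.
have /choice[f fP] (sN : seq (nat * nat) * nat) : exists nk : nat * nat,
    (0 < hmeasure g (piece sN.1))%E ->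
    [/\ (sN.2 <= nk.1)%N, heavy r g (piece sN.1) nk.1 nk.2 &
        Ink r nk.1 nk.2 (x nk.1)].
  have [/(hit _ sN.2)[n [k h]]|_] := boolP (0 < hmeasure g (piece sN.1))%E.
    by exists (n, k).
  by exists (0, 0)%N.
(* Stage [j] requests a hit of index at least [j], which makes the hits infinitely many. *)
pose s := fix s j := if j is i.+1 then f (s i, i) :: s i else [::].
have sS j : piece (s j.+1) =
    piece (s j) `&` arc (qN r (f (s j, j)).1) (f (s j, j)).2.
  by rewrite /=; case: (f _).
have s0 j : (0 < hmeasure g (piece (s j)))%E.
  by elim: j => [//|j IH]; rewrite sS; case: (fP (s j, j) IH).
have mono i j : (i <= j)%N -> piece (s j) `<=` piece (s i).
  move=> /subnK <-; elim: (j - i)%N => [//|m IH].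
  by rewrite addSn sS => y [/IH].
have /choice[y yP] (j : nat) : exists y, piece (s j) y.
  by have [y] := hmeasure_gt0_nonempty gaugeg (s0 j); exists y.
have [xi [Gxi xiP]] : G `&` cluster (y @ \oo) !=set0.
  by apply: cG; exists 0%N => // j _; apply: piece_sub (yP j).
(* From index [j.+1] on, all [y i] lie in the [j]-th arc; being closed, it contains their cluster
   point. *)
have xiarc j : arc (qN r (f (s j, j)).1) (f (s j, j)).2 xi.
  apply: closed_tball; move: xiP; rewrite clusterE; apply.
  exists j.+1 => // i /= ji.
  by have := mono _ _ ji _ (yP i); rewrite sS => -[].
exists xi; split=> // N; have [Nn _ Ix] := fP (s N, N) (s0 N).
by exists (f (s N, N)).1 => //; apply: arc_Ink_tdist Ix (xiarc N).
Qed.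

End NestedArcs.

(** * The almost sure statement *)

Unset Implicit Arguments.

Theorem theorem3p2 (R : realType) (d : measure_display) (Omega : measurableType d)
  (P : probability Omega R) (X : nat -> Omega -> R) (r : nat -> R)
  (G : set R) (g : R -> R) :
  (forall n, measurable_fun setT (X n)) ->
  (forall n (A : set R), measurable A ->
     P (X n @^-1` A) = lebesgue_measure (A `&` `[0%R, 1%R[)) ->
  (forall n, 0 < r n <= 1) ->
  compact G -> G !=set0 ->
  gauge g -> (0 < hmeasure g G)%E ->
  (Theta P X (Bcal r) < +oo)%E ->
  (\sum_(0 <= n <oo) ((r n / g (r n))%:E))%E = +oo%E ->
  {ae P, forall omega, limsup_set (fun n => X n omega) r `&` G !=set0}.
Proof.
move=> mX unifX r01 cG _ gaugeg G0 Theta_fin roo.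
have [C C0 PC] := Theta_bound mX unifX r01 Theta_fin.
(* The failure event for one piece and one starting index; there are countably many. *)
pose bad (sN : seq (nat * nat) * nat) : set Omega :=
  [set w | (0 < hmeasure g (piece r G sN.1))%E /\
     forall n k, (k < qN r n)%N ->
       (sN.2 <= n)%N && heavy r g (piece r G sN.1) n k -> ~ Ink r n k (X n w)].
have bad0 sN : P.-negligible (bad sN).
  have [E0|nE0] := boolP (0 < hmeasure g (piece r G sN.1))%E; last first.
    by apply: negligibleS (negligible_set0 P) => w []; rewrite (negbTE nE0).
  case: sN => s N in E0 *.
  (* Nothing is to be avoided before [N], so only the tail of the divergent series counts. *)
  pose K n k := (N <= n)%N && heavy r g (piece r G s) n k.
  apply: (@negligibleS _ _ _ _
    [set w | forall n k, (k < qN r n)%N -> K n k -> ~ Ink r n k (X n w)]).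
    by move=> w [].
  apply: (negligible_avoid mX r01 C0 PC) => B.
  have [c c0 hc] := heavy_proportion r01 gaugeg E0.
  have u0 i : 0 <= r i / g (r i).
    have /andP[ri _] := r01 i.
    by rewrite divr_ge0 ?(ltW ri)// gauge_ge0// ltW.
  (* The level is [B / c] because each proportion is at least [c] times the term of the series. *)
  have [M BM] := nneseries_tail_unbounded N (B / c) u0 roo.
  exists M; move: BM; rewrite ltr_pdivrMr// mulrC => BM; apply: lt_le_trans BM _.
  rewrite mulr_sumr -(big_mkord xpredT
    (fun n => (\sum_(0 <= k < qN r n) (K n k)%:R) / (qN r n)%:R)).
  have t0 n : 0 <= (\sum_(0 <= k < qN r n) (K n k)%:R) / (qN r n)%:R :> R.
    by rewrite divr_ge0// sumr_ge0.
  have [MN|NM] := leqP M N; first by rewrite [leLHS]big_geq// sumr_ge0.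
  rewrite [leRHS](@big_cat_nat _ _ _ N)// ?(ltnW NM)//=.
  apply: ler_wpDl; first by apply: sumr_ge0.
  rewrite big_nat [leRHS]big_nat; apply: ler_sum => n /andP[Nn _].
  by apply: le_trans (hc n) _; rewrite /K Nn.
have [A [mA A0 badA]] :=
  negligibleU (negligible_rational mX unifX) (negligible_bigcup_countable bad0).
exists A; split => // w /= nw; apply: badA; apply: contrapT => good; apply: nw.
have irr n : ~ rational (X n w) by move=> q; apply: good; left; exists n.
apply: (nested_hits r01 gaugeg cG G0 irr) => s N E0.
apply: contrapT => nohit; apply: good; right; exists (s, N) => //.
split=> // n k kq /andP[Nn hk] Xk; apply: nohit; exists n, k; by split.
Qed.
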